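(* Let $f_1,\dots,f_n$ be monotone linear functions. A permutation $\sigma$ of $[n]$ is minimum if and only if it is locally optimal.
   Context: A linear function is $f(x)=ax+b$; monotone means $a>0$. For a permutation $\sigma$ of $[n]$, $f^\sigma=f_{\sigma(n)}\circ\cdots\circ f_{\sigma(1)}$; $\sigma$ is minimum if $f^\sigma(x)\le f^\rho(x)$ for all $x$ and all permutations $\rho$. For $1\le\ell\le m<r\le n$, $\sigma_{\ell,m,r}$ is obtained from $\sigma$ by swapping the adjacent blocks $(\sigma(\ell),\dots,\sigma(m))$ and $(\sigma(m+1),\dots,\sigma(r))$: $\sigma_{\ell,m,r}(i)=\sigma(i)$ for $i<\ell$ or $i>r$, $=\sigma(i-\ell+m+1)$ for $\ell\le i<\ell-m+r$, $=\sigma(i+m-r)$ for $\ell-m+r\le i\le r$. $N(\sigma)=\{\sigma_{\ell,m,r}\}$, and $\sigma$ is locally optimal if $f^\sigma\le f^\mu$ pointwise for all $\mu\in N(\sigma)$. *)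

(* Defs.v *)
From HB Require Import structures.
From mathcomp Require Import all_boot all_order all_algebra all_fingroup.
Set Implicit Arguments. Unset Strict Implicit. Unset Printing Implicit Defensive.
Import Order.TTheory GRing.Theory Num.Theory.
Local Open Scope ring_scope.

Definition lin_fun (R : ringType) (p : R * R) (x : R) : R := p.1 * x + p.2.

Definition monotone_lin (R : realFieldType) (p : R * R) : Prop := 0 < p.1.

(* f^sigma = f_{sigma(n)} o ... o f_{sigma(1)}: f_{sigma(1)} is applied first.
   Positions are 0-based here: position i : 'I_n corresponds to i+1. *)
Definition comp_perm (R : ringType) (n : nat) (f : 'I_n -> R * R)
  (s : 'S_n) (x : R) : R :=
  foldl (fun y i => lin_fun (f (s i)) y) x (enum 'I_n).

(* The 1-based index map of sigma_{l,m,r}: sigma_{l,m,r}(i) = sigma(bswap l m r i). *)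
Definition bswap (l m r i : nat) : nat :=
  if (i < l)%N || (r < i)%N then i
  else if (i < l + r - m)%N then (i - l + m + 1)%N
  else (i + m - r)%N.

(* mu = sigma_{l,m,r} for some 1 <= l <= m < r <= n (1-based indices;
   0-based position i corresponds to 1-based i+1). *)
Definition in_nbhd (n : nat) (s mu : 'S_n) : Prop :=
  exists l m r : nat,
    [/\ (1 <= l)%N, (l <= m)%N, (m < r)%N, (r <= n)%N &
      forall i j : 'I_n, val j = (bswap l m r (val i).+1).-1 -> mu i = s j].

Definition is_minimum (R : realFieldType) (n : nat) (f : 'I_n -> R * R)
  (s : 'S_n) : Prop :=
  forall (rho : 'S_n) (x : R), comp_perm f s x <= comp_perm f rho x.

Definition locally_optimal (R : realFieldType) (n : nat) (f : 'I_n -> R * R)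
  (s : 'S_n) : Prop :=
  forall mu : 'S_n, in_nbhd s mu -> forall x : R, comp_perm f s x <= comp_perm f mu x.

(* Main.v *)
(* All compositions have the same slope, so only the intercepts matter.  Attach
   to f = a x + b the plane vector (a - 1, b): a block A placed before an
   adjacent block B is at least as good as B before A iff the cross product of
   their vectors is nonnegative, and a composite h o g has vector
   h.1 * vec g + vec h.

   Let x, y be the first two functions of a locally optimal sequence, and induct
   on the length.  Merging x and y into one function keeps local optimality, so
   the sequence beats every ordering in which x, y are consecutive; dropping x
   likewise shows that it beats every ordering which ends with x.  A global
   minimizer can be turned into one of these two shapes by block swaps that cost
   nothing: otherwise some function would lie strictly between x and y in
   counterclockwise order, which local optimality forbids. *)
Require Import Defs.
From mathcomp Require Import all_boot all_order all_algebra all_fingroup.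
From mathcomp Require Import ring lra zify.
Import Order.TTheory GRing.Theory Num.Theory.
Local Open Scope ring_scope.

(** * Composition of linear functions and the cross product *)

Section Lists.
Set Implicit Arguments.
Unset Strict Implicit.
Context {R : realFieldType}.
Implicit Types (g h k l m q x y : R * R) (s r A B M P Q : seq (R * R)).

Definition after g h : R * R := (h.1 * g.1, h.1 * g.2 + h.2).

Definition comp s : R * R := foldl after (1, 0) s.

(** Also the intercept of [after h g] minus that of [after g h]. *)
Definition cross g h : R := (g.1 - 1) * h.2 - g.2 * (h.1 - 1).

Definition positive s := all (fun g => 0 < g.1) s.

(** Local optimality on lists, by [comp_swap]. Empty blocks are harmless: the identity has vector
    zero. *)
Definition block_optimal s :=
  forall P A B Q, s = P ++ A ++ B ++ Q -> 0 <= cross (comp A) (comp B).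

Definition minimizes s r :=
  perm_eq s r /\ forall r', perm_eq s r' -> (comp r).2 <= (comp r').2.

Lemma foldl_after g s : foldl after g s = after g (comp s).
Proof.
rewrite /comp; elim: s g => [|h s IHs] g /=.
  by case: g => a b; rewrite /after /= !mul1r addr0.
rewrite IHs [in RHS]IHs /after /=; congr pair; ring.
Qed.

Lemma comp1 g : comp [:: g] = g.
Proof. by case: g => a b; rewrite /comp /= /after /= mulr1 mulr0 add0r. Qed.

Lemma comp_cat A B : comp (A ++ B) = after (comp A) (comp B).
Proof. by rewrite {1}/comp foldl_cat foldl_after. Qed.

Lemma comp_cons g s : comp (g :: s) = after g (comp s).
Proof. by rewrite -cat1s comp_cat comp1. Qed.

Lemma comp_foldl s (x : R) :
  foldl (fun (z : R) g => lin_fun g z) x s = (comp s).1 * x + (comp s).2.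
Proof.
elim: s x => [|g s IHs] x; first by rewrite /comp /= mul1r addr0.
rewrite /= IHs comp_cons /after /lin_fun /=; ring.
Qed.

Lemma comp_slope s : (comp s).1 = \prod_(g <- s) g.1.
Proof.
elim: s => [|g s IHs]; first by rewrite big_nil.
by rewrite comp_cons big_cons /= IHs mulrC.
Qed.

Lemma comp_slope_perm s r : perm_eq s r -> (comp s).1 = (comp r).1.
Proof. by move=> sr; rewrite !comp_slope (perm_big _ sr). Qed.

Lemma comp_slope_gt0 s : positive s -> 0 < (comp s).1.
Proof.
move=> /allP s_gt0; rewrite comp_slope big_seq.
by apply: prodr_gt0 => g /s_gt0.
Qed.

Lemma cross_afterl g h k : cross (after g h) k = h.1 * cross g k + cross h k.
Proof. rewrite /cross /after /=; ring. Qed.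

Lemma cross_afterr g h k : cross k (after g h) = h.1 * cross k g + cross k h.
Proof. rewrite /cross /after /=; ring. Qed.

Lemma crossC g h : cross g h = - cross h g.
Proof. rewrite /cross; ring. Qed.

Lemma cross_id g : cross (comp [::]) g = 0.
Proof. rewrite /cross /comp /=; ring. Qed.

Lemma cross_plucker g h k l :
  cross g h * cross k l - cross g k * cross h l + cross g l * cross h k = 0.
Proof. rewrite /cross; ring. Qed.

(** Slopes commute, so the contribution of [P] cancels, and [Q] only scales the difference. *)
Lemma comp_swap P A B Q :
  (comp (P ++ B ++ A ++ Q)).2 - (comp (P ++ A ++ B ++ Q)).2
    = (comp Q).1 * cross (comp A) (comp B).
Proof. rewrite !comp_cat /cross /after /=; ring. Qed.

(** * Minimizers and swaps that cost nothing *)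

Lemma perm_swap s P A B Q :
  perm_eq s (P ++ A ++ B ++ Q) = perm_eq s (P ++ B ++ A ++ Q).
Proof.
by apply: (permPr _); rewrite perm_cat2l; apply/permPl/perm_catCA.
Qed.

Lemma positive_perm s r : perm_eq s r -> positive s -> positive r.
Proof. by move=> sr; rewrite /positive (perm_all _ sr). Qed.

Lemma minimizes_block_optimal s r :
  positive s -> minimizes s r -> block_optimal r.
Proof.
move=> s_gt0 [sr minr] P A B Q rE; subst r.
have /minr : perm_eq s (P ++ B ++ A ++ Q) by rewrite perm_swap.
rewrite -subr_ge0 comp_swap pmulr_rge0 //; apply: comp_slope_gt0.
by have := positive_perm sr s_gt0; rewrite /positive !all_cat => /and4P[].
Qed.

Lemma minimizes_swap s P A B Q :
  positive s -> minimizes s (P ++ A ++ B ++ Q) ->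
  cross (comp A) (comp B) <= 0 -> minimizes s (P ++ B ++ A ++ Q).
Proof.
move=> s_gt0 [sr minr] AB; split; first by rewrite perm_swap.
move=> r' sr'; apply: le_trans (minr _ sr').
rewrite -subr_le0 comp_swap pmulr_rle0 //; apply: comp_slope_gt0.
by have := positive_perm sr s_gt0; rewrite /positive !all_cat => /and4P[].
Qed.

Lemma minimizer_exists s : exists r, minimizes s r.
Proof.
have least (S : seq (seq (R * R))) r0 :
    exists2 r, r \in r0 :: S & {in r0 :: S, forall r', (comp r).2 <= (comp r').2}.
  elim: S r0 => [|r1 S IHS] r0.
    by exists r0; rewrite ?mem_head // => r'; rewrite inE => /eqP->.
  have [r rS rmin] := IHS r1.
  have [le|lt] := leP (comp r0).2 (comp r).2.
    exists r0; rewrite ?mem_head // => r'; rewrite inE => /predU1P[->//|r'S].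
    exact: le_trans le (rmin _ r'S).
  exists r; first by rewrite inE rS orbT.
  by move=> r'; rewrite inE => /predU1P[->|/rmin//]; apply: ltW.
(* [s] is put in front so that the list of candidates is visibly nonempty. *)
have [r rS rmin] := least (permutations s) s.
have perm_mem r' : (r' \in s :: permutations s) = perm_eq s r'.
  rewrite inE mem_permutations perm_sym.
  by case: eqP => // ->; rewrite perm_refl.
exists r; split; first by rewrite -perm_mem.
by move=> r'; rewrite -perm_mem => /rmin.
Qed.

(* Block-optimality makes the partial composites a convex chain; the next three
   lemmas are the resulting restrictions on its turns, all consequences of the
   Pluecker relation between four plane vectors. *)
Lemma no_return x y k m :
  0 < k.1 -> 0 < m.1 ->
  0 <= cross x y -> 0 <= cross x (after y k) -> 0 <= cross (after y k) m ->
  0 <= cross y (after k m) -> 0 < cross x m -> cross m y <= 0.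
Proof.
move=> k0 m0; rewrite cross_afterl !cross_afterr => xy xyk ykm ykm' xm.
rewrite leNgt; apply/negP => my.
have := cross_plucker x y k m.
move: xyk ykm ykm' xm xy my; rewrite (crossC y m).
move: (cross x y) (cross x k) (cross k m) (cross y k) (cross x m) (cross m y).
move=> xy xk km yk xm my xyk ykm ykm' xm0 xy0 my0.
have yk0 : 0 < yk by rewrite -(pmulr_rgt0 _ m0); lra.
(* The Pluecker sum regroups into this positive product and the next two nonnegative ones, so it
   cannot vanish. *)
have := mulr_gt0 xm0 yk0.
have : 0 <= xy * (km - k.1 * my) by apply: mulr_ge0 => //; lra.
have : 0 <= (k.1 * xy + xk) * my by apply: mulr_ge0 => //; lra.
nra.
Qed.

Lemma last_in_cone x y k m :
  0 <= cross x y -> 0 < cross x k -> 0 <= cross k m ->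
  0 <= cross x (after k m) -> 0 < cross (after k m) y -> 0 < cross m y ->
  0 < m.1 -> 0 < cross x m.
Proof.
rewrite cross_afterl cross_afterr (crossC k y) => xy xk km xkm kmy my m0.
rewrite ltNge; apply/negP => xm.
have := cross_plucker x y k m; rewrite (crossC y m).
move: xy xk km xkm kmy my xm.
move: (cross x y) (cross x k) (cross k m) (cross y k) (cross x m) (cross m y).
move=> xy xk km yk xm my xy0 xk0 km0 xkm kmy my0 xm0 E.
have := mulr_ge0 xy0 km0.
(* If [yk <= 0], no term of the Pluecker sum is negative and [xk * my] is positive; otherwise the
   terms with [xk] and [xm] regroup into two products, the first positive. *)
have [yk0|yk0] := leP yk 0.
  have := mulr_gt0 xk0 my0.
  have : 0 <= (- xm) * (- yk) by apply: mulr_ge0; lra.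
  nra.
have : 0 < xk * (my - m.1 * yk) by apply: mulr_gt0 => //; lra.
have : 0 <= (m.1 * xk + xm) * yk by apply: mulr_ge0; lra.
nra.
Qed.

Lemma first_after x y k q :
  0 < x.1 -> 0 <= cross x y -> 0 <= cross k x -> 0 <= cross (after k x) q ->
  0 < cross x q -> cross q y <= 0 -> cross y (after k x) <= 0.
Proof.
rewrite cross_afterl cross_afterr (crossC k x) (crossC q y) (crossC y x) => x0.
have := cross_plucker x y k q.
move: (cross x y) (cross x k) (cross k q) (cross y q) (cross x q) (cross y k).
move=> xy xk kq yq xq yk E xy0 xk0 kxq xq0 yq0.
rewrite leNgt; apply/negP => ykx.
(* [x.1] times the Pluecker sum is the sum of the next three products. *)
have : 0 < xq * (x.1 * yk - xy) by apply: mulr_gt0 => //; lra.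
have : 0 <= xy * (x.1 * kq + xq) by apply: mulr_ge0 => //; lra.
have : 0 <= x.1 * (- xk * yq).
  by apply: mulr_ge0; [exact: ltW | apply: mulr_ge0; lra].
nra.
Qed.

(** * Making [x] and [y] consecutive in a minimizer *)

(** [no_return] applies with [k] the composite of the functions between [y] and [m]. *)
Lemma head_cone_empty x y s m :
  positive [:: x, y & s] -> block_optimal [:: x, y & s] -> m \in s ->
  0 < cross x m -> cross m y <= 0.
Proof.
move=> + + ms; case/splitPr: ms => N N'.
rewrite /positive /= all_cat /= => /and5P[_ _ N0 m0 _] opt xm.
apply: (@no_return x y (comp N) m) => //.
- exact: comp_slope_gt0.
- by have := opt [::] [:: x] [:: y] (N ++ m :: N') erefl; rewrite !comp1.
- have := opt [::] [:: x] (y :: N) (m :: N') erefl.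
  by rewrite (comp_cons y) comp1.
- by have := opt [:: x] (y :: N) [:: m] N' erefl; rewrite (comp_cons y) comp1.
- have := opt [:: x] [:: y] (rcons N m) N'.
  by rewrite -cats1 comp_cat !comp1 -catA; apply.
Qed.

(** Induction on the gap [M]: a free swap closes or shortens it. If none of those tried is free, the
    last function of the gap lies strictly between [x] and [y], which [head_cone_empty] excludes. *)
Lemma bring_together x y s P M Q :
  positive [:: x, y & s] -> block_optimal [:: x, y & s] ->
  minimizes [:: x, y & s] (P ++ x :: M ++ y :: Q) ->
  exists P' Q', minimizes [:: x, y & s] (P' ++ x :: y :: Q').
Proof.
move=> s0 opt; have [n] := ubnP (size M); elim: n P M Q => // n IHn P M Q.
case/lastP: M => [|M m]; first by exists P, Q.
rewrite size_rcons cat_rcons ltnS => Mn minr.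
have optr := minimizes_block_optimal s0 minr.
have [Mm_y|Mm_y] := leP (cross (comp (rcons M m)) y) 0.
  exists P, (rcons M m ++ Q).
  have := @minimizes_swap _ (P ++ [:: x]) (rcons M m) [:: y] Q s0.
  by rewrite -!catA /= cat_rcons comp1; apply.
have [xMm|xMm] := leP (cross x (comp (rcons M m))) 0.
  exists (P ++ rcons M m), Q.
  have := @minimizes_swap _ P [:: x] (rcons M m) (y :: Q) s0.
  by rewrite -!catA /= cat_rcons comp1; apply.
have [my|my] := leP (cross m y) 0.
  apply: (IHn P M (m :: Q)) => //.
  have := @minimizes_swap _ (P ++ x :: M) [:: m] [:: y] Q s0.
  by rewrite -!catA /= !comp1; apply.
(* For empty [M] this swap would not shorten the gap, so that case is kept apart. *)
have [/andP[M0 xM]|] := boolP ((0 < size M)%N && (cross x (comp M) <= 0)).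
  apply: (IHn (P ++ M) [:: m] Q); first exact: leq_ltn_trans Mn.
  by rewrite -catA; apply: (@minimizes_swap _ P [:: x] M); rewrite ?comp1.
rewrite negb_and -leqNgt leqn0 -ltNge => M_cases.
have {M_cases} xM : size M = 0%N \/ 0 < cross x (comp M).
  by case/orP: M_cases => [/eqP|]; [left|right].
have ms : m \in s.
  have : perm_eq s (P ++ M ++ m :: Q).
    have := minr.1.
    rewrite -(perm_cons y) -(perm_cons x) => /seq.permP memP; apply/seq.permP => a.
    by move: (memP a); rewrite /= !count_cat /= !count_cat /=; lia.
  by move/perm_mem->; rewrite !mem_cat mem_head !orbT.
suff /(head_cone_empty s0 opt ms) : 0 < cross x m by rewrite leNgt my.
case: xM => [M0|xM]; first by rewrite (size0nil M0) comp1 in xMm.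
move: Mm_y xMm; rewrite -cats1 comp_cat comp1 => Mm_y xMm.
apply: (@last_in_cone x y (comp M) m) => //.
- by have := opt [::] [:: x] [:: y] s erefl; rewrite !comp1.
- have := optr (P ++ [:: x]) M [:: m] (y :: Q).
  by rewrite -!catA comp1; apply.
- exact: ltW.
- by move/allP: s0; apply; rewrite !inE ms !orbT.
Qed.

(** [x] is pushed to the right while that is free. If it stops before some [q], then
    [cross q y <= 0] by [head_cone_empty], and [first_after] makes moving [y] past [M] and [x]
    free. *)
Lemma bring_together_rev x y s P M Q :
  positive [:: x, y & s] -> block_optimal [:: x, y & s] ->
  minimizes [:: x, y & s] (P ++ y :: M ++ x :: Q) ->
  (exists P' Q', minimizes [:: x, y & s] (P' ++ x :: y :: Q')) \/
  (exists P', minimizes [:: x, y & s] (rcons P' x)).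
Proof.
move=> s0 opt; elim: Q M => [|q Q IHQ] M minr.
  by right; exists (P ++ y :: M); rewrite rcons_cat /= -cats1.
have optr := minimizes_block_optimal s0 minr.
have [xq|xq] := leP (cross x q) 0.
  apply: (IHQ (rcons M q)); rewrite cat_rcons.
  have := @minimizes_swap _ (P ++ y :: M) [:: x] [:: q] Q s0.
  by rewrite -!catA /= !comp1; apply.
left; exists (P ++ M), (q :: Q).
have qs : q \in s.
  have : perm_eq s (P ++ M ++ q :: Q).
    have := minr.1.
    rewrite -(perm_cons y) -(perm_cons x) => /seq.permP memP; apply/seq.permP => a.
    by move: (memP a); rewrite /= !count_cat /= !count_cat /=; lia.
  by move/perm_mem->; rewrite !mem_cat mem_head !orbT.
have := @minimizes_swap _ P [:: y] (rcons M x) (q :: Q) s0.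
rewrite -!catA /= !cat_rcons comp1; apply=> //.
rewrite -cats1 comp_cat comp1; apply: (@first_after x y (comp M) q) => //.
- by case/andP: s0.
- by have := opt [::] [:: x] [:: y] s erefl; rewrite !comp1.
- have := optr (P ++ [:: y]) M [:: x] (q :: Q).
  by rewrite -!catA comp1; apply.
- have := optr (P ++ [:: y]) (rcons M x) [:: q] Q.
  by rewrite -!catA /= cat_rcons -cats1 comp_cat !comp1; apply.
- exact: head_cone_empty s0 opt qs xq.
Qed.

(** * Block optimality implies minimality *)

Lemma block_optimal_minimal s r :
  positive s -> block_optimal s -> perm_eq s r -> (comp s).2 <= (comp r).2.
Proof.
have [n] := ubnP (size s); elim: n s r => // n IHn [|x [|y s]] r.
- by rewrite perm_sym => _ _ _ /perm_small_eq->.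
- by rewrite perm_sym => _ _ _ /perm_small_eq->.
rewrite /= ltnS => sn s0 opt sr.
have adjacent P Q : perm_eq [:: x, y & s] (P ++ [:: x, y & Q]) ->
    (comp [:: x, y & s]).2 <= (comp (P ++ [:: x, y & Q])).2.
  move=> memP.
  have merge A B : comp (A ++ after x y :: B) = comp (A ++ [:: x, y & B]).
    by rewrite !comp_cat !comp_cons /after /=; congr pair; ring.
  rewrite -[X in comp X]cat0s -!merge; apply: IHn => //=.
  - have /and3P[x0 y0 ->] := s0; by rewrite mulr_gt0.
  (* A block that starts with the merged function unfolds to one that starts with [x], [y]. *)
  - move=> [|p P'] [|a A] B Q' //=; rewrite ?cross_id //.
    + case=> <- sE.
      have -> := merge [::] A : comp (_ :: A) = _.
      by apply: (opt [::] [:: x, y & A] B Q'); rewrite sE.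
    + case=> _ sE.
      by have := opt [:: x, y & P'] (a :: A) B Q'; rewrite sE => /(_ erefl).
  - move/seq.permP: memP => memP; apply/seq.permP => a.
    by move: (memP a); rewrite /= !count_cat /=; lia.
have [r0 minr0] := minimizer_exists [:: x, y & s].
apply: le_trans (minr0.2 _ sr).
have : (exists P' Q', minimizes [:: x, y & s] (P' ++ x :: y :: Q')) \/
  (exists P', minimizes [:: x, y & s] (rcons P' x)).
  have : x \in r0 by rewrite -(perm_mem minr0.1) mem_head.
  move=> xr0; case/splitPr: xr0 minr0 => P Q minr.
  have : y \in P ++ Q.
    have : perm_eq (y :: s) (P ++ Q).
      have := minr.1.
      rewrite -(perm_cons x) => /seq.permP memP; apply/seq.permP => a.
      by move: (memP a); rewrite /= !count_cat /=; lia.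
    by move/perm_mem <-; apply: mem_head.
  rewrite mem_cat => /orP[] /splitPr yE; case: yE minr => A B minr.
    by rewrite -catA in minr; apply: bring_together_rev minr.
  by left; apply: bring_together minr.
move=> [[P [Q min1]]|[P min1]]; apply: le_trans (min1.2 _ minr0.1).
  exact: adjacent min1.1.
have tail : (comp (y :: s)).2 <= (comp P).2.
  apply: IHn => //; first by case/andP: s0.
    move=> P' A B Q' E.
    by apply: (opt (x :: P') A B Q'); rewrite E.
  rewrite -(perm_cons x); apply: perm_trans min1.1 _.
  by apply/permPl/perm_rcons.
have x0 : 0 < x.1 by case/andP: s0.
(* Swapping [x] with all the rest moves [x] to the end, which cannot lower the intercept. *)
have /= := opt [::] [:: x] (y :: s) [::].
rewrite comp1 cats0 => /(_ erefl) xs.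
apply: (@le_trans _ _ (comp (rcons (y :: s) x)).2).
  rewrite -cats1 comp_cons comp_cat comp1 -subr_ge0.
  rewrite (_ : _ - _ = cross x (comp (y :: s))) //.
  rewrite /cross /after /=; ring.
by rewrite -!cats1 !comp_cat !comp1 /after /= lerD2r ler_pM2l.
Qed.

End Lists.

(** * From permutations to lists *)

Section Permutations.
Set Implicit Arguments.
Unset Strict Implicit.
Context {R : realFieldType} {n : nat}.
Implicit Types (f : 'I_n -> R * R) (s : 'S_n).

Definition ordering f s : seq (R * R) := [seq f (s i) | i <- enum 'I_n].

Lemma size_ordering f s : size (ordering f s) = n.
Proof. by rewrite size_map size_enum_ord. Qed.

Lemma nth_ordering f s z (i : 'I_n) : nth z (ordering f s) i = f (s i).
Proof. by rewrite (nth_map i) ?size_enum_ord // nth_ord_enum. Qed.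

Lemma comp_permE f s x :
  comp_perm f s x = (comp (ordering f s)).1 * x + (comp (ordering f s)).2.
Proof.
rewrite -comp_foldl /comp_perm /ordering.
by elim: (enum 'I_n) x => //= i e IHe x; rewrite IHe.
Qed.

Lemma perm_ordering f s s' : perm_eq (ordering f s) (ordering f s').
Proof.
have inv t : perm_eq [seq f i | i <- enum 'I_n] (ordering f t).
  rewrite /ordering (map_comp f t) perm_map // uniq_perm ?enum_uniq //.
    by rewrite map_inj_uniq ?enum_uniq //; exact: perm_inj.
  move=> i; rewrite mem_enum; apply/esym/mapP; exists ((t^-1)%g i).
    by rewrite mem_enum.
  by rewrite permKV.
by rewrite -(permPl (inv s)) inv.
Qed.

Lemma positive_ordering f s :
  (forall i, monotone_lin (f i)) -> positive (ordering f s).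
Proof. by move=> f0; apply/allP => g /mapP[i _ ->]; apply: f0. Qed.

(** The bounds of [bswap] are 1-based, hence [p.+1] for the start of [A]; the outer successor and
    predecessor convert positions. *)
Lemma nth_bswap (T : Type) (z : T) (P A B Q : seq T) (p := size P)
    (a := size A) (b := size B) i :
  nth z (P ++ B ++ A ++ Q) i =
  nth z (P ++ A ++ B ++ Q) (bswap p.+1 (p + a) (p + a + b) i.+1).-1.
Proof.
rewrite /bswap !nth_cat -/p -/a -/b; do ![case: ifPn]; move=> *;
  by [congr nth; lia | exfalso; lia].
Qed.

(** Together with [bswap_inj], turns the index map into a permutation of ['I_n]. *)
Lemma bswap_lt l m r i :
  (0 < l <= m)%N -> (m < r <= n)%N -> (i < n)%N ->
  ((bswap l m r i.+1).-1 < n)%N.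
Proof. rewrite /bswap; do ![case: ifPn]; lia. Qed.

Lemma bswap_inj l m r i j :
  (0 < l <= m)%N -> (m < r)%N ->
  (bswap l m r i.+1).-1 = (bswap l m r j.+1).-1 -> i = j.
Proof. rewrite /bswap; do ![case: ifPn]; lia. Qed.

Lemma locally_optimal_block_optimal f s :
  (forall i, monotone_lin (f i)) -> locally_optimal f s ->
  block_optimal (ordering f s).
Proof.
(* Neighbours swap nonempty blocks only; with an empty block the cross product is zero. *)
move=> f0 opt P [|a A] [|b B] Q sE; rewrite ?cross_id //.
  by rewrite crossC cross_id oppr0.
set l := (size P).+1; set m := (size P + size (a :: A))%N.
set r := (m + size (b :: B))%N.
have lm : (0 < l <= m)%N by rewrite /l /m /=; lia.
have mr : (m < r)%N by rewrite /r /=; lia.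
have rn : (r <= n)%N.
  by rewrite -(size_ordering f s) sE !size_cat /r /m; lia.
have mrn : (m < r <= n)%N by rewrite mr.
pose g i := Ordinal (bswap_lt lm mrn (ltn_ord i)).
have g_inj : injective g.
  by move=> i j /(congr1 val) /= /(bswap_inj lm mr) /val_inj.
(* The product of permutations applies its left factor first. *)
pose mu : 'S_n := (perm g_inj * s)%g.
have muE i : mu i = s (g i) by rewrite permM permE.
have mu_ordering : ordering f mu = P ++ (b :: B) ++ (a :: A) ++ Q.
  apply: (@eq_from_nth _ 0) => [|i].
    by rewrite size_ordering -[LHS](size_ordering f s) sE !size_cat
      [X in (_ + X)%N]addnCA.
  rewrite size_ordering => i_n.
  rewrite nth_bswap -sE -/l -/m -/r.
  rewrite (nth_ordering f mu 0 (Ordinal i_n)) muE.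
  by rewrite -(nth_ordering f s 0).
have nbhd : in_nbhd s mu.
  exists l, m, r; split=> // i j jE.
  by rewrite muE; congr (s _); apply: val_inj; rewrite jE.
(* At 0 the composites evaluate to their intercepts. *)
have := opt mu nbhd 0; rewrite !comp_permE !mulr0 !add0r mu_ordering sE.
rewrite -subr_ge0 comp_swap pmulr_rge0 //; apply: comp_slope_gt0.
have := positive_ordering s f0.
by rewrite sE /positive !all_cat => /and4P[].
Qed.

End Permutations.

Theorem mainTheorem12 (R : realFieldType) (n : nat) (f : 'I_n -> R * R)
  (hmono : forall i : 'I_n, monotone_lin (f i)) (s : 'S_n) :
  is_minimum f s <-> locally_optimal f s.
Proof.
split=> [smin mu _ x|/(locally_optimal_block_optimal hmono) opt rho x].
  exact: smin.
have sr := perm_ordering f s rho.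
rewrite !comp_permE (comp_slope_perm sr) lerD2l.
exact: block_optimal_minimal (positive_ordering s hmono) opt sr.
Qed.
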